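(* Let $A:\mathbb{R}^N\to\mathbb{R}^N$ be a linear operator, let $c\in\mathbb{R}^N$, and let $u^*$ denote the (unique) solution of $Au=c$. Let $K:\mathbb{R}^N\to\mathbb{R}^N$ be a symmetric positive definite linear operator, with induced norm $\|v\|_{\mathcal H}^2=\langle v,Kv\rangle$. Let $\sigma,\tau>0$ be stepsizes and let $k>0$ be such that $$\|A^TK^{-1}A\| = k,\qquad \sigma\tau<\frac1k .$$ For arbitrary initial data $u^0,\phi^0,\tilde\phi^0\in\mathbb{R}^N$, let $(u^n,\phi^n,\tilde\phi^n)_{n\ge 1}$ be the iterates of the preconditioned primal-dual hybrid gradient algorithm for the problem $\min_u\max_\phi\langle Au-c,\phi\rangle$, with primal stepsize $\sigma$, dual stepsize $\tau$ and dual proximal norm $\|\cdot\|_{\mathcal H}$. Then $$\lim_{n\to\infty}\left(Au^n-Au^*\right)=0 .$$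
   Context: $\langle\cdot,\cdot\rangle$ is the Euclidean inner product on $\mathbb{R}^N$, $\|\cdot\|_{L^2}$ the Euclidean norm, $A^T$ the transpose of $A$, and $\|A^TK^{-1}A\|$ the operator norm induced by the Euclidean norm. The preconditioned (general-proximal) primal-dual hybrid gradient algorithm for $\min_u\max_\phi \langle Au-c,\phi\rangle$ with primal stepsize $\sigma$ and dual stepsize $\tau$ is, for $n\ge 1$, $$u^n=\operatorname*{arg\,min}_{u\in\mathbb{R}^N}\ \langle Au-c,\tilde\phi^{n-1}\rangle+\frac{1}{2\sigma}\|u-u^{n-1}\|_{L^2}^2,$$ $$\phi^n=\operatorname*{arg\,max}_{\phi\in\mathbb{R}^N}\ \langle Au^n-c,\phi\rangle-\frac{1}{2\tau}\|\phi-\phi^{n-1}\|_{\mathcal H}^2,$$ $$\tilde\phi^n=2\phi^n-\phi^{n-1}.$$ Equivalently, $u^n=u^{n-1}-\sigma A^T\tilde\phi^{n-1}$ and $\phi^n=\phi^{n-1}+\tau K^{-1}(Au^n-c)$. *)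

(* Defs.v *)
From HB Require Import structures.
From mathcomp Require Import all_boot all_order all_algebra.
From mathcomp Require Import all_classical all_reals all_analysis.
Set Implicit Arguments.
Unset Strict Implicit.
Unset Printing Implicit Defensive.
Import Order.TTheory GRing.Theory Num.Theory.
Import numFieldNormedType.Exports.
Local Open Scope classical_set_scope.
Local Open Scope ring_scope.

Section Euclidean.
Context {R : realType} {N : nat}.
Implicit Types (u v : 'cV[R]_N) (K M : 'M[R]_N).

Definition dot u v : R := \sum_i u i 0 * v i 0.

(* The library norm `|v| on 'cV[R]_N is the max norm, not this one. *)
Definition l2norm v : R := Num.sqrt (dot v v).

(* In finite dimension the set below is nonempty and bounded, so [sup] is
   its genuine supremum. *)
Definition opnorm M : R := sup [set l2norm (M *m v) | v in [set v | l2norm v <= 1]].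

Definition sym_posdef K : Prop :=
  K^T = K /\ forall v, v != 0 -> 0 < dot v (K *m v).

Definition Hnorm K v : R := Num.sqrt (dot v (K *m v)).

End Euclidean.

Definition argmin {R : realType} {T : Type} (f : T -> R) : set T :=
  [set x | forall y, f x <= f y].

Definition argmax {R : realType} {T : Type} (f : T -> R) : set T :=
  [set x | forall y, f y <= f x].

(* The values at index 0 are left unconstrained: they are the initial data. *)
Definition pdhg_iterates {R : realType} {N : nat} (A K : 'M[R]_N) (c : 'cV[R]_N)
    (sigma tau : R) (u phi phit : nat -> 'cV[R]_N) : Prop :=
  forall n : nat,
    [/\ argmin (fun v => dot (A *m v - c) (phit n)
                         + 1 / (2 * sigma) * l2norm (v - u n) ^+ 2) (u n.+1),
        argmax (fun psi => dot (A *m u n.+1 - c) psi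
                           - 1 / (2 * tau) * Hnorm K (psi - phi n) ^+ 2) (phi n.+1)
      & phit n.+1 = 2 *: phi n.+1 - phi n].

(* Main.v *)
(** The dual variable can be eliminated: with [B = sigma tau A^T K^-1 A] and [C = 1 - B], the errors
    [e n = u n - ustar] satisfy [e n.+2 = C (2 e n.+1 - e n)] for [n >= 1], where
    [B] is symmetric positive semidefinite and [C >= delta > 0] by the step-size
    condition.  In an eigenbasis of [B] the characteristic roots have squared
    modulus [C], so [Q n = |e n.+1 - C e n|^2 + <e n, B C e n>] is a natural
    Lyapunov function; it drops by at least [delta |B e n|^2] at each step.
    Hence [B e n] tends to [0], and so does [A e n] because [A] is invertible. *)
Require Import Defs.
From mathcomp Require Import all_boot all_order all_algebra.
From mathcomp Require Import all_classical all_reals all_analysis.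
From mathcomp Require Import ring lra.
Import Order.TTheory GRing.Theory Num.Theory.
Import numFieldNormedType.Exports.
Local Open Scope classical_set_scope.
Local Open Scope ring_scope.

Section Dot.
Context {R : realType} {N : nat}.
Implicit Types (u v w : 'cV[R]_N) (M K : 'M[R]_N).

Lemma dotC u v : dot u v = dot v u.
Proof. by apply: eq_bigr => i _; rewrite mulrC. Qed.

Lemma dotDl u v w : dot (u + v) w = dot u w + dot v w.
Proof. by rewrite /dot -big_split; apply: eq_bigr => i _; rewrite mxE mulrDl. Qed.

Lemma dotZl a u v : dot (a *: u) v = a * dot u v.
Proof. by rewrite /dot mulr_sumr; apply: eq_bigr => i _; rewrite mxE mulrA. Qed.

Lemma dotNl u v : dot (- u) v = - dot u v.
Proof. by rewrite -scaleN1r dotZl mulN1r. Qed.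

Lemma dotDr u v w : dot u (v + w) = dot u v + dot u w.
Proof. by rewrite dotC dotDl !(dotC u). Qed.

Lemma dotZr a u v : dot u (a *: v) = a * dot u v.
Proof. by rewrite dotC dotZl (dotC u). Qed.

Lemma dotNr u v : dot u (- v) = - dot u v.
Proof. by rewrite dotC dotNl (dotC u). Qed.

Definition dotE := (dotDl, dotDr, dotNl, dotNr, dotZl, dotZr).

Lemma dot_mull M u v : dot (M *m u) v = dot u (M^T *m v).
Proof.
have dot_mx (a b : 'cV[R]_N) : dot a b = (a^T *m b) 0 0.
  by rewrite mxE; apply: eq_bigr => i _; rewrite mxE.
by rewrite !dot_mx trmx_mul mulmxA.
Qed.

Lemma dot_ge0 v : 0 <= dot v v.
Proof. by apply: sumr_ge0 => i _; rewrite -expr2 sqr_ge0. Qed.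

Lemma sqr_le_dot v i : v i 0 ^+ 2 <= dot v v.
Proof.
rewrite /dot (bigD1 i) //= -expr2 lerDl.
by apply: sumr_ge0 => j _; rewrite -expr2 sqr_ge0.
Qed.

Lemma dot_le0 v : dot v v <= 0 -> v = 0.
Proof.
move=> v0; apply/matrixP => i j; rewrite ord1 mxE; apply/eqP.
by rewrite -sqrf_eq0 eq_le sqr_ge0 (le_trans (sqr_le_dot v i) v0).
Qed.

Lemma sqr_l2norm v : l2norm v ^+ 2 = dot v v.
Proof. by rewrite sqr_sqrtr ?dot_ge0. Qed.

Lemma posdef_ge0 K v : sym_posdef K -> 0 <= dot v (K *m v).
Proof.
case=> _ Kpos; have [->|/Kpos/ltW//] := eqVneq v 0.
by rewrite mulmx0 dot_ge0.
Qed.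

Lemma posdef_le0 K v : sym_posdef K -> dot v (K *m v) <= 0 -> v = 0.
Proof. by case=> _ Kpos; have [//|/Kpos] := eqVneq v 0; rewrite ltNge => /negP. Qed.

Lemma sqr_Hnorm K v : sym_posdef K -> Hnorm K v ^+ 2 = dot v (K *m v).
Proof. by move=> Kpos; rewrite sqr_sqrtr ?posdef_ge0. Qed.

Lemma inj_unitmx M : (forall v, M *m v = 0 -> v = 0) -> M \in unitmx.
Proof.
(* [det0P] yields a row vector in the left kernel, hence the passage to [M^T]. *)
move=> Minj; rewrite -unitmx_tr unitmxE unitfE; apply/det0P => -[v /eqP v0 vM].
apply: v0; rewrite -[v]trmxK (Minj v^T) ?trmx0 //.
by rewrite -[M]trmxK -trmx_mul vM trmx0.
Qed.

Lemma posdef_unitmx K : sym_posdef K -> K \in unitmx.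
Proof.
move=> Kpos; apply: inj_unitmx => v Kv; apply: (posdef_le0 _ _ Kpos).
by rewrite Kv -(scale0r 0) dotZr mul0r.
Qed.

(* If the set in the definition of [opnorm] were unbounded, [sup] would be the
   junk value 0; so [0 < opnorm M] alone makes it a genuine supremum. *)
Lemma opnorm_bound M v : 0 < opnorm M ->
  dot (M *m v) (M *m v) <= opnorm M ^+ 2 * dot v v.
Proof.
move=> M0; set S := [set l2norm (M *m v) | v in [set v | l2norm v <= 1]].
have supS : has_sup S.
  by apply: contrapT => /sup_out S0; move: M0; rewrite /opnorm -/S S0 ltxx.
have [->|vn0] := eqVneq v 0; first by rewrite mulmx0 -(scale0r 0) !dotE !mul0r mulr0.
have v0 : 0 < dot v v by rewrite ltNge; apply: contra vn0 => /dot_le0 ->.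
have l0 : 0 < l2norm v by rewrite sqrtr_gt0.
pose w := (l2norm v)^-1 *: v.
have w1 : l2norm w <= 1.
  rewrite /l2norm /w !dotE -sqr_l2norm expr2 mulKf ?gt_eqF // mulVf ?gt_eqF //.
  by rewrite sqrtr1.
have : l2norm (M *m w) <= opnorm M by apply: ub_le_sup; [exact: supS.2|exists w].
rewrite -(ler_pXn2r (n:=2)) ?nnegrE ?sqrtr_ge0 ?(ltW M0) // sqr_l2norm.
rewrite /w -scalemxAr !dotE mulrA -expr2 exprVn sqr_l2norm.
by rewrite mulrC ler_pdivrMr.
Qed.

(** With [k = opnorm M], expand [0 <= |k v - M v|^2], bound [|M v|^2] by [k^2 |v|^2] and divide by
    [2 k]. *)
Lemma dot_opnorm M v : 0 < opnorm M -> dot v (M *m v) <= opnorm M * dot v v.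
Proof.
move=> M0; have := opnorm_bound M v M0; have := dot_ge0 (opnorm M *: v - M *m v).
rewrite !dotE (dotC (M *m v) v); set k := opnorm M in M0 *.
move=> h1 h2; rewrite -(ler_pM2l M0); lra.
Qed.

(** Completing the square replaces differentiation: the objective at [x] exceeds its value at the
    claimed point by exactly their squared distance over [2 * sigma]. *)
Lemma argmin_prox (A : 'M[R]_N) (c p u x : 'cV[R]_N) (sigma : R) : 0 < sigma ->
  argmin (fun v => dot (A *m v - c) p + 1 / (2 * sigma) * l2norm (v - u) ^+ 2) x ->
  x = u - sigma *: (A^T *m p).
Proof.
move=> s0 xmin; apply/eqP; rewrite -subr_eq0; apply/eqP/dot_le0.
set g := A^T *m p; move: (xmin (u - sigma *: g)); rewrite !sqr_l2norm.
have Ag v : dot (A *m v - c) p = dot v g - dot c p by rewrite !dotE dot_mull.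
rewrite !Ag -(ler_pM2l (mulr_gt0 (ltr0n _ 2) s0)) => h; rewrite -subr_ge0.
move: h; rewrite -subr_ge0; congr (0 <= _).
rewrite !dotE (dotC g u) (dotC g x) (dotC u x); field.
by rewrite gt_eqF.
Qed.

Lemma argmax_prox (K : 'M[R]_N) (q p x : 'cV[R]_N) (tau : R) :
  sym_posdef K -> 0 < tau ->
  argmax (fun psi => dot q psi - 1 / (2 * tau) * Hnorm K (psi - p) ^+ 2) x ->
  x = p + tau *: (invmx K *m q).
Proof.
move=> Kpos t0 xmax; apply/eqP; rewrite -subr_eq0; apply/eqP.
apply: (posdef_le0 _ _ Kpos); set g := invmx K *m q.
move: (xmax (p + tau *: g)); rewrite !sqr_Hnorm //.
have Kg : K *m g = q by rewrite mulmxA mulmxV ?(posdef_unitmx _ Kpos) // mul1mx.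
have Ksym a b : dot a (K *m b) = dot b (K *m a) by rewrite -[K in RHS]Kpos.1 -dot_mull dotC.
(* With [q = K *m g] the linear term is a [K]-inner product, so the gap is again an exact square,
   now in the [K]-norm. *)
rewrite -Kg (dotC (K *m g)) (dotC (K *m g)).
rewrite -(ler_pM2l (mulr_gt0 (ltr0n _ 2) t0)) => h; rewrite -subr_ge0.
move: h; rewrite -subr_ge0; congr (0 <= _).
rewrite !(mulmxDr, mulmxN, =^~ scalemxAr) !dotE.
rewrite (Ksym g p) (Ksym g x) (Ksym p x); field.
by rewrite gt_eqF.
Qed.

Lemma lyapunov_cvg (B : 'M[R]_N) (delta : R) (x : nat -> 'cV[R]_N) :
  B^T = B -> (forall v, 0 <= dot v (B *m v)) -> 0 < delta ->
  (forall v, dot v (B *m v) <= (1 - delta) * dot v v) ->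
  (forall n, let y := 2 *: x n.+1 - x n in x n.+2 = y - B *m y) ->
  (fun n => dot (B *m x n) (B *m x n)) @ \oo --> (0 : R).
Proof.
move=> Bsym B0 d0 Bd rec.
have adjB a b : dot (B *m a) b = dot a (B *m b) by rewrite dot_mull Bsym.
pose C v := v - B *m v.
pose w n := x n.+1 - C (x n).
(* As [C^2 + B C = C], this is [|x n.+1|^2 - 2 <x n.+1, C x n> + <x n, C x n>], the characteristic
   polynomial [r^2 - 2 C r + C] made homogeneous. *)
pose Q n := dot (w n) (w n) + dot (x n) (B *m C (x n)).
have C0 v : delta * dot v v <= dot v (C v).
  by have := Bd v; rewrite /C !dotE; lra.
(* [B C = C B C + B C B], as [B + C = 1] *)
have Q0 n : 0 <= Q n.
  have h1 := B0 (C (x n)); have h2 := C0 (B *m x n).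
  have h3 := mulr_ge0 (ltW d0) (dot_ge0 (B *m x n)).
  apply: addr_ge0; first exact: dot_ge0.
  apply: le_trans (addr_ge0 h1 (le_trans h3 h2)) _; rewrite le_eqVlt.
  by apply/orP; left; apply/eqP; rewrite /C !(mulmxDr, mulmxN) !dotE !adjB; ring.
(* The recurrence gives [w n.+1 = C (x n.+1 - x n)]; the rest follows from [B + C = 1] and the
   symmetry of [B]. *)
have Qdec n : Q n - Q n.+1 = dot (w n) (B *m w n) + dot (B *m x n) (C (B *m x n)).
  rewrite /Q /w rec /C; set y := x n.+1; set z := x n.
  rewrite !(mulmxDr, mulmxN, =^~ scalemxAr) !dotE !adjB.
  by rewrite !(dotC y z) !(dotC y (B *m _)) !adjB; ring.
have Qdrop n : delta * dot (B *m x n) (B *m x n) <= Q n - Q n.+1.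
  by rewrite Qdec; have := B0 (w n); have := C0 (B *m x n); lra.
have Qcvg : cvgn Q.
  apply: nonincreasing_is_cvgn; last by exists 0 => _ [n _ <-].
  apply/nonincreasing_seqP => n; rewrite -subr_ge0; apply: le_trans (Qdrop n).
  by rewrite mulr_ge0 ?dot_ge0 ?ltW.
(* Consecutive differences of the convergent sequence [Q] vanish in the limit, which squeezes
   [|B x n|^2]. *)
have dcvg : (fun n => delta^-1 * (Q n - Q n.+1)) @ \oo --> (0 : R).
  rewrite -(mulr0 delta^-1) -(subrr (limn Q)).
  apply: cvgMr; apply: cvgB => //.
  by rewrite (cvg_shiftS Q).
apply: (squeeze_cvgr _ (cvg_cst 0) dcvg); near=> n.
by rewrite dot_ge0 /= mulrC ler_pdivlMr // mulrC Qdrop.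
Unshelve. all: by end_near. Qed.

(** Bridges the Euclidean norm and the entrywise topology of matrices: coordinates are controlled by
    [sqr_le_dot], and there are finitely many entries. *)
Lemma cvg_mulmx0 M (y : nat -> 'cV[R]_N) :
  (fun n => dot (y n) (y n)) @ \oo --> (0 : R) ->
  (fun n => M *m y n) @ \oo --> (0 : 'cV[R]_N).
Proof.
move=> y0; have ycvg i : (fun n => y n i 0) @ \oo --> (0 : R).
  apply/cvgr0Pnorm_lt => e e0; near=> n.
  rewrite -(ltr_pXn2r (n:=2)) ?nnegrE ?(ltW e0) // real_normK ?num_real //.
  apply: le_lt_trans (sqr_le_dot (y n) i) _.
  rewrite -[ltLHS]ger0_norm ?dot_ge0 //.
  by near: n; apply: (cvgr0_norm_lt _ y0); rewrite exprn_gt0.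
apply/cvg_ballP => e e0.
have My i j : (fun n => (M *m y n) i j) @ \oo --> (0 : R).
  rewrite ord1; under eq_fun do rewrite mxE.
  have sum0 : \sum_(l < N) M i l * 0 = 0 :> R by rewrite big1 // => l _; rewrite mulr0.
  rewrite -[x in nbhs x]sum0.
  apply: (cvg_big (op:=+%R)) => [|l _]; first exact: add_continuous.
  by apply: cvgMr; exact: ycvg.
near=> n; split=> // i j; rewrite mxE; move: i j; near: n.
apply: filter_forall => i; apply: filter_forall => j.
exact: (cvg_ball (My i j) e0).
Unshelve. all: by end_near. Qed.

End Dot.

Theorem proposition2p1 (R : realType) (N : nat) (A : 'M[R]_N) (c ustar : 'cV[R]_N)
    (hustar : [set v : 'cV[R]_N | A *m v = c] = [set ustar])
    (K : 'M[R]_N) (hK : sym_posdef K)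
    (sigma tau k : R) (hsigma : 0 < sigma) (htau : 0 < tau) (hk : 0 < k)
    (hnorm : opnorm (A^T *m invmx K *m A) = k)
    (hstep : sigma * tau < 1 / k)
    (u phi phit : nat -> 'cV[R]_N)
    (hiter : pdhg_iterates A K c sigma tau u phi phit) :
  (fun n : nat => A *m u n - A *m ustar) @ \oo --> (0 : 'cV[R]_N).
Proof.
have Aus : A *m ustar = c by have : [set ustar] ustar by []; rewrite -hustar.
have Aunit : A \in unitmx.
  (* Adding a kernel vector to [ustar] gives another solution, so uniqueness kills the kernel. *)
  apply: inj_unitmx => v Av; apply: (addrI ustar); rewrite addr0.
  by have : [set v | A *m v = c] (ustar + v); [rewrite /= mulmxDr Av addr0|rewrite hustar].
have Kunit := posdef_unitmx _ hK.
pose s := sigma * tau; have s0 : 0 < s by rewrite mulr_gt0.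
pose M := A^T *m invmx K *m A; pose B := s *: M.
pose e n := u n - ustar.
have Msym : M^T = M by rewrite !trmx_mul trmxK trmx_inv hK.1 mulmxA.
have M0 v : 0 <= dot v (M *m v).
  (* For [w = K^-1 A v], [<w, K w>] equals [<v, M v>]. *)
  have := posdef_ge0 _ (invmx K *m (A *m v)) hK.
  rewrite [K *m _]mulmxA mulmxV // mul1mx dotC dot_mull.
  by rewrite !mulmxA.
have ustep n : u n.+1 = u n - sigma *: (A^T *m phit n).
  by case: (hiter n) => /(argmin_prox _ _ _ _ _ _ hsigma).
have phistep n : phi n.+1 = phi n + tau *: (invmx K *m (A *m e n.+1)).
  by rewrite /e mulmxBr Aus; case: (hiter n) => _ /(argmax_prox _ _ _ _ _ hK htau).
have phitE n : phit n.+1 = 2 *: phi n.+1 - phi n by case: (hiter n).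
(* The recurrence starts at [e 1]: it compares two consecutive extrapolated duals, and [phit 0] is
   arbitrary. *)
have erec n : let y := 2 *: e n.+2 - e n.+1 in e n.+3 = y - B *m y.
  have estep m : e m.+1 = e m - sigma *: (A^T *m phit m) by rewrite /e ustep addrAC.
  have dphi : phit n.+2 = phit n.+1 + tau *: (invmx K *m (A *m (2 *: e n.+2 - e n.+1))).
    rewrite !phitE (phistep n.+1) (phistep n) !(mulmxBr, =^~ scalemxAr).
    by apply/matrixP => i j; rewrite !mxE; ring.
  move=> y; rewrite (estep n.+2) dphi -/y mulmxDr -scalemxAr !mulmxA -/M.
  (* The leftover [phit n.+1] is read off the previous primal step, which eliminates the dual
     variable. *)
  rewrite scalerDr scalerA -/s -scalemxAl [in LHS](_ : sigma *: _ = e n.+1 - e n.+2).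
    by apply/matrixP => i j; rewrite /y !mxE; ring.
  by rewrite (estep n.+1) opprB addrCA subrr addr0.
have cvgB : (fun n => dot (B *m e n.+1) (B *m e n.+1)) @ \oo --> (0 : R).
  (* Since [M <= k], [1 - B >= 1 - s * k], which is positive by [hstep]. *)
  apply: (lyapunov_cvg B (1 - s * k) _ _ _ _ _ erec).
  - by rewrite linearZ /= Msym.
  - by move=> v; rewrite -scalemxAl dotZr mulr_ge0 ?M0 ?ltW.
  - by rewrite subr_gt0 -ltr_pdivlMr.
  - move=> v; rewrite -scalemxAl dotZr subKr -(mulrA s k) ler_pM2l // -hnorm.
    by apply: dot_opnorm; rewrite hnorm.
(* This factor undoes [s A^T K^-1], so its product with [B] is [A]. *)
have := cvg_mulmx0 (s^-1 *: (K *m invmx A^T)) _ cvgB.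
rewrite -(cvg_shiftS (fun n => A *m u n - _)).
apply: cvg_trans; apply: near_eq_cvg; apply: nearW => n /=.
rewrite -mulmxBr -/(e n.+1) /B -!scalemxAl -scalemxAr scalerA mulVf ?gt_eqF // scale1r.
by rewrite /M !mulmxA mulmxKV ?unitmx_tr // mulmxV // mul1mx.
Qed.
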